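(* Let $\omega$ be a circle in the plane with centre $O$ and radius $r_\omega>0$, let $l$ be a line tangent to $\omega$ at $T$, and let $X$ be an arbitrary point on $l$. Let $m$ be the other tangent line from $X$ to $\omega$, let $R=m\cap\omega$ be its point of tangency, and let $X'$ be the reflection of $X$ on $m$ with respect to $R$ (i.e. $X'\in m$ is the point such that $R$ is the midpoint of $XX'$). Then $t(\omega,l)$, the locus of $X'$ as $X$ ranges over $l$, is a Maclaurin trisectrix. Conversely, for every Maclaurin trisectrix $t$ there exist a circle $\omega$ and a line $l$ tangent to $\omega$ such that $t=t(\omega,l)$, i.e. $t$ is generated by $\omega$ and $l$ as described.
   Context: The Maclaurin trisectrix is the cubic plane curve defined as the locus of the point of intersection of two lines, each rotating at a uniform rate about separate points, so that the ratio of the rates of rotation is $1:3$ and the lines initially coincide with the line passing through the two points. Concretely, a curve in the Euclidean plane is a Maclaurin trisectrix if for some $a>0$ it has, in a suitable polar coordinate system, the polar equation $r=a\sec\frac{\theta}{3}$ (with $-\frac{3\pi}{2}<\theta<\frac{3\pi}{2}$); equivalently, in a suitable Cartesian coordinate system (with a different origin, at the double point of the curve) it has the equation $y^2=\frac{x^2(x+3a)}{a-x}$. For the degenerate position $X=T$ of the moving point, where the two tangents coincide, one takes $m=l$, $R=T$ and $X'=T$. *)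

(* Defs.v *)
From HB Require Import structures.
From mathcomp Require Import all_boot all_order all_algebra.
From mathcomp Require Import all_classical all_reals all_analysis.

Set Implicit Arguments.
Unset Strict Implicit.
Unset Printing Implicit Defensive.

Import Order.TTheory GRing.Theory Num.Theory.

Local Open Scope classical_set_scope.
Local Open Scope ring_scope.

Definition plane (R : realType) := 'rV[R]_2.

Definition dot (R : realType) (u v : plane R) : R := (u *m v^T) 0 0.

(* The library norm `|_| on row vectors is the sup norm, hence this one. *)
Definition enorm (R : realType) (u : plane R) : R := Num.sqrt (dot u u).

Definition circle (R : realType) (O : plane R) (r : R) : set (plane R) :=
  [set P | enorm (P - O) = r].

Definition is_line (R : realType) (l : set (plane R)) : Prop :=
  exists A d : plane R, d != 0 /\ l = range (fun s : R => A + s *: d).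

Definition tangent_at (R : realType) (w l : set (plane R)) (P : plane R) : Prop :=
  is_line l /\ l `&` w = [set P].

(* [other_tangent w l T X m Q]: [l] being tangent to the circle [w] at [T], the
   line [m] is the other tangent from [X \in l], and [Q] its point of tangency.
   The first disjunct is the limiting convention for the position [X = T],
   where the two tangents coincide. *)
Definition other_tangent (R : realType) (w l : set (plane R)) (T X : plane R)
    (m : set (plane R)) (Q : plane R) : Prop :=
  [/\ X = T, m = l & Q = T] \/
  [/\ X <> T, m X, m <> l & tangent_at w m Q].

Definition reflection (R : realType) (Q X : plane R) : plane R := Q *+ 2 - X.

(* The curve t(w, l); the tangency point [T] is determined by [w] and [l]. *)
Definition tangent_locus (R : realType) (w l : set (plane R)) : set (plane R) :=
  [set X' | exists (T X : plane R) (m : set (plane R)) (Q : plane R),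
     [/\ tangent_at w l T, l X, other_tangent w l T X m Q
       & X' = reflection Q X]].

(* Image of the pair of polar coordinates (rho, theta) in the polar coordinate
   system with pole [C] and polar axis [u], where [(u, v)] is an orthonormal
   frame, of either orientation. *)
Definition polar_point (R : realType) (C u v : plane R) (rho theta : R) : plane R :=
  C + rho *: (cos theta *: u + sin theta *: v).

Definition maclaurin_trisectrix (R : realType) (t : set (plane R)) : Prop :=
  exists (a : R) (C u v : plane R),
    [/\ 0 < a, [/\ enorm u = 1, enorm v = 1 & dot u v = 0]
      & t = [set polar_point C u v (a * (cos (theta / 3))^-1) theta
            | theta in `](- (3 * pi / 2)), (3 * pi / 2)[%classic ]].

(* Main.v *)
Require Import Defs.
From mathcomp Require Import all_boot all_order all_algebra.
From mathcomp Require Import all_classical all_reals all_analysis.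
From mathcomp Require Import ring lra.
Import Order.TTheory GRing.Theory Num.Theory.
Local Open Scope classical_set_scope.
Local Open Scope ring_scope.

(** Put the origin at the centre [O] and choose an orthonormal frame [(u, v)]
    for which the tangency point of [l] is [r u]; then [l] is the line [x = r],
    and its points are [X = (r, r tan phi)] with [|phi| < pi / 2].  The two
    tangents from [X] are symmetric about [OX], a ray at angle [phi] from [u],
    so the other one touches the circle at the point of polar angle [2 phi],
    and the reflected point is
      [X' = r (2 cos (2 phi) - 1, 2 sin (2 phi) - tan phi)].
    The triple-angle formulas turn this into
      [X' = (r / cos phi) (cos (3 phi), sin (3 phi))],
    which is the polar equation of the trisectrix, with pole [O], axis [u],
    parameter [a = r] and [theta = 3 phi].  Every circle with a tangent line
    has such a frame, and every frame with a parameter [a > 0] comes from such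
    a pair, so one computation settles both directions.

    The geometry is computed with the rational parameter [t = tan phi].
    [tangentP] replaces a tangent line, given as a line meeting the circle once,
    by the linear equation [(X - O) . (Q - O) = r ^ 2].  This makes the point of
    contact of a tangent from [X] a root of a quadratic with one known root
    ([other_tangentP]), whence a rational parametrization of the locus
    ([tangent_locus_framed]).  The substitution [t = tan (theta / 3)], a
    bijection onto the real line, identifies it with the polar curve
    ([polar_trisectrix_framed]). *)

Section PlaneGeometry.
Set Implicit Arguments.
Unset Strict Implicit.
Unset Printing Implicit Defensive.

Variable R : realType.
Implicit Types (P Q X O T u v w q d : plane R) (r a b x y s : R).

(** * Inner product and orthogonality in the plane *)

Lemma plane_eqP P Q : P 0 0 = Q 0 0 -> P 0 1 = Q 0 1 -> P = Q.
Proof.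
move=> e0 e1; apply/rowP => i.
case: i => -[|[|//]] hi; [move: e0|move: e1];
  by congr (_ = _); congr (_ _ _); apply: val_inj.
Qed.

Lemma sub_origin P Q O : P - Q = P - O - (Q - O).
Proof. by rewrite opprB addrA subrK. Qed.

Lemma dotE u v : dot u v = u 0 0 * v 0 0 + u 0 1 * v 0 1.
Proof.
rewrite /dot !mxE !big_ord_recl big_ord0 addr0 !mxE.
by congr (_ + _ * _); congr (_ _ _); apply: val_inj.
Qed.

Lemma dotC u v : dot u v = dot v u.
Proof. by rewrite !dotE; ring. Qed.

Lemma dotDl u v w : dot (u + v) w = dot u w + dot v w.
Proof. by rewrite !dotE !mxE; ring. Qed.

Lemma dotZl a u w : dot (a *: u) w = a * dot u w.
Proof. by rewrite !dotE !mxE; ring. Qed.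

Lemma dotDr u v w : dot w (u + v) = dot w u + dot w v.
Proof. by rewrite dotC dotDl !(dotC w). Qed.

Lemma dotZr a u w : dot w (a *: u) = a * dot w u.
Proof. by rewrite dotC dotZl dotC. Qed.

Lemma dotBl u v w : dot (u - v) w = dot u w - dot v w.
Proof. by rewrite !dotE !mxE; ring. Qed.

Lemma dot_sqrB u v : dot (u - v) (u - v) = dot u u - 2 * dot u v + dot v v.
Proof. by rewrite !dotE !mxE; ring. Qed.

Lemma dot_ge0 u : 0 <= dot u u.
Proof. by rewrite dotE addr_ge0 // -expr2 sqr_ge0. Qed.

Lemma dot_eq0 u : (dot u u == 0) = (u == 0).
Proof.
apply/eqP/eqP => [|->]; last by rewrite dotE !mxE; ring.
move/eqP; rewrite dotE -!expr2 paddr_eq0 ?sqr_ge0 // !sqrf_eq0.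
by case/andP => /eqP h0 /eqP h1; apply: plane_eqP; rewrite ?h0 ?h1 mxE.
Qed.

Lemma enormE u r : 0 <= r -> enorm u = r <-> dot u u = r ^+ 2.
Proof.
move=> r0; split=> [<-|h]; first by rewrite sqr_sqrtr ?dot_ge0.
by rewrite /enorm h sqrtr_sqr ger0_norm.
Qed.

Lemma circleE O r P : 0 <= r ->
  circle O r P <-> dot (P - O) (P - O) = r ^+ 2.
Proof. exact: enormE. Qed.

Definition rot90 u : plane R := \row_i (if i == 0 then - u 0 1 else u 0 0).

Lemma dot_rot90 u : dot u (rot90 u) = 0.
Proof. by rewrite dotE !mxE /=; ring. Qed.

Lemma dot_rot90_rot90 u : dot (rot90 u) (rot90 u) = dot u u.
Proof. by rewrite !dotE !mxE /=; ring. Qed.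

Lemma orthogonal_decomposition q w :
  dot q q *: w = dot w q *: q + dot w (rot90 q) *: rot90 q.
Proof. by apply: plane_eqP; rewrite !mxE !dotE !mxE /=; ring. Qed.

(** In dimension two the orthogonal complement of a nonzero vector is a line;
    this is why a tangent line is determined by its point of contact. *)
Lemma orthogonal_rot90 q d : q != 0 -> dot d q = 0 ->
  d = (dot d (rot90 q) / dot q q) *: rot90 q.
Proof.
rewrite -dot_eq0 => q0 dq.
apply: (scalerI q0); rewrite orthogonal_decomposition dq scale0r add0r scalerA.
by congr (_ *: _); field.
Qed.

Definition orthonormal u v := [/\ dot u u = 1, dot v v = 1 & dot u v = 0].

(** Only the sign of [v] relative to [rot90 u] is undetermined, and that sign
    squares to one in the expansion, so both orientations are covered. *)
Lemma orthonormal_expansion u v w : orthonormal u v ->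
  w = dot w u *: u + dot w v *: v.
Proof.
case=> uu vv uv.
have u0 : u != 0 by rewrite -dot_eq0 uu oner_neq0.
have := @orthogonal_rot90 u v u0; rewrite dotC uv => /(_ erefl).
rewrite uu divr1; set e := dot v _ => ve.
have e2 : e * e = 1 by rewrite -[1]vv ve dotZl dotZr dot_rot90_rot90 uu mulr1.
have := orthogonal_decomposition u w; rewrite uu scale1r => {1}->.
by rewrite [in RHS]ve dotZr scalerA mulrAC e2 mul1r.
Qed.

(** * Tangent lines of a circle *)

(** If a line through a point [Q] of the circle meets it only there, its
    direction is orthogonal to the radius, so the line is the polar of [Q].
    Conversely, a point [X] of that polar with [|X - O| = r] has
    [|X - Q|^2 = r^2 - 2 r^2 + r^2 = 0].  Being an equation in [X] and [Q]
    that is symmetric in both, the polar form is what turns the search for the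
    tangents through [X] into algebra. *)
Lemma tangentP O r m Q : 0 < r ->
  tangent_at (circle O r) m Q <->
  circle O r Q /\ m = [set X | dot (X - O) (Q - O) = r ^+ 2].
Proof.
move=> r0; have r0' := ltW r0.
split=> [[[A [d [d0 ml]]] mc]|[cQ ml]].
- have [mQ cQ] : (m `&` circle O r) Q by rewrite mc.
  split=> //; move/(circleE _ _ r0'): (cQ) => qq.
  have dd : dot d d != 0 by rewrite dot_eq0.
  have {ml}ml : m = range (fun s : R => Q + s *: d).
    move: mQ; rewrite {1}ml => -[s0 _ QA]; rewrite {}ml -{}QA.
    apply/seteqP; split=> _ [s _ <-].
      by exists (s - s0) => //; rewrite -addrA -scalerDl [s0 + _]addrC subrK.
    by exists (s0 + s) => //; rewrite scalerDl addrA.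
  have [q qE] : exists q, q = Q - O by eexists.
  rewrite -qE in qq *.
  have QO s : Q + s *: d - O = q + s *: d by rewrite addrAC qE.
  (* A line oblique to the radius would meet the circle a second time, at the
     nonzero root [s] of the quadratic that cuts out the intersection. *)
  have dq : dot d q = 0.
    pose s := - (2 * dot d q / dot d d).
    have : (m `&` circle O r) (Q + s *: d).
      split; first by rewrite ml; exists s.
      apply/(circleE _ _ r0'); rewrite QO !(dotDl, dotDr, dotZl, dotZr) qq.
      by rewrite (dotC q d) /s; field.
    rewrite mc => /eqP; rewrite -subr_eq0 addrAC subrr add0r scaler_eq0.
    rewrite (negbTE d0) orbF oppr_eq0 !mulf_eq0 invr_eq0 (negbTE dd) orbF.
    by rewrite pnatr_eq0 /= => /eqP.
  have q0 : q != 0 by rewrite -dot_eq0 qq expf_neq0 ?gt_eqF.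
  rewrite ml; apply/seteqP; split=> [_ [s _ <-]|X /= hX].
    by rewrite /= QO dotDl dotZl dq mulr0 addr0.
  have XQ : dot (X - Q) q = 0.
    by rewrite (sub_origin X Q O) -qE dotBl hX qq subrr.
  have dE := orthogonal_rot90 q0 dq.
  have c0 : dot d (rot90 q) / dot q q != 0.
    by apply: contraNneq d0 => c0; rewrite dE c0 scale0r.
  exists (dot (X - Q) (rot90 q) / dot q q / (dot d (rot90 q) / dot q q)) => //.
  rewrite {2}dE scalerA divfK // -orthogonal_rot90 //.
  by rewrite addrC subrK.
- move/(circleE _ _ r0'): (cQ) => qq.
  have q0 : Q - O != 0 by rewrite -dot_eq0 qq expf_neq0 ?gt_eqF.
  split.
    exists Q, (rot90 (Q - O)); split.
      by rewrite -dot_eq0 dot_rot90_rot90 dot_eq0.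
    rewrite ml; apply/seteqP; split=> [X /= hX|_ [s _ <-] /=].
      exists (dot (X - Q) (rot90 (Q - O)) / dot (Q - O) (Q - O)) => //.
      rewrite -orthogonal_rot90 //; first by rewrite addrC subrK.
      by rewrite (sub_origin X Q O) dotBl hX qq subrr.
    by rewrite addrAC dotDl dotZl (dotC (rot90 _)) dot_rot90 mulr0 addr0.
  apply/seteqP; split=> [X [mX /(circleE _ _ r0') cX]|_ ->].
    move: mX; rewrite ml /= => mX.
    apply/eqP; rewrite -subr_eq0 -dot_eq0 (sub_origin X Q O).
    by rewrite dot_sqrB cX mX qq; apply/eqP; ring.
  by split; rewrite // ml.
Qed.

Lemma tangent_at_inj (w l : set (plane R)) P Q :
  tangent_at w l P -> tangent_at w l Q -> P = Q.
Proof. by move=> [_ h] [_]; rewrite h => e; have : [set P] P by []; rewrite e. Qed.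

(** * Coordinates in an orthonormal frame *)

Definition framed O u v x y : plane R := O + (x *: u + y *: v).

Lemma framedP O u v X : orthonormal u v -> exists x y, X = framed O u v x y.
Proof.
move=> /(orthonormal_expansion (X - O)) h.
exists (dot (X - O) u), (dot (X - O) v).
by rewrite /framed -h addrC subrK.
Qed.

Lemma dot_framed O u v x y x' y' : orthonormal u v ->
  dot (framed O u v x y - O) (framed O u v x' y' - O) = x * x' + y * y'.
Proof.
move=> [uu vv uv].
rewrite /framed !(addrC O) !addrK !(dotDl, dotDr, dotZl, dotZr) (dotC v) uu vv uv.
by ring.
Qed.

Lemma framed_inj O u v x y x' y' : orthonormal u v ->
  framed O u v x y = framed O u v x' y' -> x = x' /\ y = y'.
Proof.
move=> uv e; split.
  have := dot_framed O x y 1 0 uv; rewrite e dot_framed //; lra.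
have := dot_framed O x y 0 1 uv; rewrite e dot_framed //; lra.
Qed.

Lemma reflection_framed O u v x y x' y' :
  reflection (framed O u v x y) (framed O u v x' y') =
  framed O u v (2 * x - x') (2 * y - y').
Proof. by apply: plane_eqP; rewrite /reflection /framed !mxE; ring. Qed.

(** * The locus in the frame of the tangency point *)

Section Frame.
Variables (O u v : plane R) (r : R).
Hypotheses (r0 : 0 < r) (uv : orthonormal u v).
Notation F := (framed O u v).
Notation tangent_line := [set X | dot (X - O) (F r 0 - O) = r ^+ 2].

Let rN0 : r != 0. Proof. by rewrite gt_eqF. Qed.

Lemma circle_framed x y : circle O r (F x y) <-> x ^+ 2 + y ^+ 2 = r ^+ 2.
Proof.
have r0' := ltW r0.
by split=> [/(circleE _ _ r0')|h]; [|apply/(circleE _ _ r0')];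
  rewrite dot_framed // -!expr2.
Qed.

Lemma tangent_frame : tangent_at (circle O r) tangent_line (F r 0).
Proof. by apply/tangentP => //; split=> //; apply/circle_framed; ring. Qed.

Lemma tangent_line_framed x y : tangent_line (F x y) <-> x = r.
Proof.
rewrite /= dot_framed // mulr0 addr0 expr2.
by split=> [/(mulIf rN0)|->].
Qed.

(** With [t = tan phi], the right-hand side is the point of the circle at angle
    [2 phi].  The contact point [(x, y)] of a tangent from [(r, r t)] satisfies
    [x + t y = r] and [x^2 + y^2 = r^2]; eliminating [x] leaves a quadratic in
    [y] with the root [0], which is the given tangent, so the other tangent is
    the other root.  At [t = 0] the two roots coincide and the formula gives
    the point of tangency of the given line, in accordance with the convention
    for the degenerate position; hence no case distinction in the formula. *)
Lemma other_tangentP t Q :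
  (exists m, other_tangent (circle O r) tangent_line (F r 0) (F r (r * t)) m Q)
  <-> Q = F (r * ((1 - t ^+ 2) / (1 + t ^+ 2))) (r * (2 * t / (1 + t ^+ 2))).
Proof.
have tN0 : 1 + t ^+ 2 != 0 by rewrite gt_eqF // ltr_pwDl // sqr_ge0.
split=> [[m [[XT _ ->]|[XT mX ml]]]|QE].
- case: (framed_inj uv XT) => _ /eqP.
  rewrite mulf_eq0 (negbTE rN0) => /eqP ->.
  by congr framed; field.
- case/tangentP=> // cQ mE.
  have [x [y QE]] := framedP O Q uv.
  move: mX; rewrite mE QE /= dot_framed // => hX.
  move: cQ; rewrite QE => /circle_framed hQ.
  have xE : x = r - t * y.
    by apply: (mulfI rN0); rewrite mulrBr -expr2 -hX; ring.
  have : y * (y * (1 + t ^+ 2) - 2 * r * t) = 0.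
    by move: hQ; rewrite xE => hQ; lra.
  move=> /eqP; rewrite mulf_eq0 => /orP[/eqP y0|].
    (* The root [y = 0] is the given tangent itself. *)
    by case: ml; rewrite mE QE xE y0 mulr0 subr0.
  rewrite subr_eq0 => /eqP yE.
  have {}yE : y = r * (2 * t / (1 + t ^+ 2)).
    by apply: (mulIf tN0); rewrite yE; field.
  by rewrite xE yE; congr framed; field.
- have cQ : circle O r Q by rewrite QE; apply/circle_framed; field.
  case: (eqVneq t 0) QE => [-> QE|t0 QE].
    exists tangent_line; left; split=> //; first by rewrite mulr0.
    by rewrite QE; congr framed; field.
  exists [set X | dot (X - O) (Q - O) = r ^+ 2]; right.
  have tQ : tangent_at (circle O r) [set X | dot (X - O) (Q - O) = r ^+ 2] Q.
    exact/tangentP.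
  split=> //.
  + move/(framed_inj uv) => [_ /eqP].
    by rewrite mulf_eq0 (negbTE rN0) (negbTE t0).
  + by rewrite /= QE dot_framed //; field.
  + move=> e; move: tQ; rewrite e => /tangent_at_inj/(_ tangent_frame).
    rewrite QE => /(framed_inj uv)[_ /eqP].
    by rewrite !mulf_eq0 invr_eq0 (negbTE tN0) (negbTE t0) (negbTE rN0) pnatr_eq0.
Qed.

Lemma tangent_locus_framed :
  tangent_locus (circle O r) tangent_line =
  range (fun t => F (r * ((1 - 3 * t ^+ 2) / (1 + t ^+ 2)))
                    (r * (t * (3 - t ^+ 2) / (1 + t ^+ 2)))).
Proof.
have tN0 (t : R) : 1 + t ^+ 2 != 0 by rewrite gt_eqF // ltr_pwDl // sqr_ge0.
apply/seteqP; split=> [X' [T [X [m [Q [hT lX hm ->]]]]]|_ [t _ <-]].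
  rewrite (tangent_at_inj hT tangent_frame) in hm.
  have [x [y XE]] := framedP O X uv.
  move: lX; rewrite XE => /tangent_line_framed xr.
  have yE : y = r * (y / r) by field.
  move: hm; rewrite XE xr yE; set t := y / r => hm.
  have /other_tangentP -> : exists m,
    other_tangent (circle O r) tangent_line (F r 0) (F r (r * t)) m Q by exists m.
  exists t => //; rewrite reflection_framed; congr framed; by field.
have /other_tangentP [m hm] := erefl
  (F (r * ((1 - t ^+ 2) / (1 + t ^+ 2))) (r * (2 * t / (1 + t ^+ 2)))).
exists (F r 0), (F r (r * t)), m; eexists; split; [|  |exact: hm|].
- exact: tangent_frame.
- exact/tangent_line_framed.
- by rewrite reflection_framed; congr framed; field.
Qed.
End Frame.

(** * Identification with the polar curve *)

(** The triple-angle formulas divided by [cos x], with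
    [1 + tan^2 x = 1 / cos^2 x]. *)
Lemma polar_point_framed O u v r x : cos x != 0 ->
  polar_point O u v (r * (cos x)^-1) (3 * x) =
  framed O u v (r * ((1 - 3 * tan x ^+ 2) / (1 + tan x ^+ 2)))
               (r * (tan x * (3 - tan x ^+ 2) / (1 + tan x ^+ 2))).
Proof.
move=> cx.
have x3 : 3 * x = x + x + x by ring.
rewrite -cos2_tan2 // x3 /polar_point scalerDr !scalerA.
by congr (_ + (_ *: _ + _ *: _)); rewrite !(cosD, sinD) /tan; field.
Qed.

Lemma polar_trisectrix_framed O u v r :
  [set polar_point O u v (r * (cos (theta / 3))^-1) theta
     | theta in `](- (3 * pi / 2)), (3 * pi / 2)[%classic] =
  range (fun t => framed O u v (r * ((1 - 3 * t ^+ 2) / (1 + t ^+ 2)))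
                               (r * (t * (3 - t ^+ 2) / (1 + t ^+ 2)))).
Proof.
apply/seteqP; split=> [_ [th /= + <-]|_ [t _ <-]].
  rewrite in_itv /= => /andP[h1 h2]; exists (tan (th / 3)) => //.
  rewrite -polar_point_framed; first by congr polar_point; field.
  by apply/lt0r_neq0/cos_gt0_pihalf; lra.
have h1 := atan_gtNpi2 t; have h2 := atan_ltpi2 t.
have th3 : 3 * atan t / 3 = atan t by field.
exists (3 * atan t); first by rewrite /= in_itv /=; lra.
rewrite th3 polar_point_framed ?atanK //.
by apply/lt0r_neq0/cos_gt0_pihalf; lra.
Qed.

Lemma tangent_locus_polar O u v r : 0 < r -> orthonormal u v ->
  tangent_locus (circle O r)
    [set X | dot (X - O) (framed O u v r 0 - O) = r ^+ 2] =
  [set polar_point O u v (r * (cos (theta / 3))^-1) theta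
     | theta in `](- (3 * pi / 2)), (3 * pi / 2)[%classic].
Proof. by move=> r0 uv; rewrite polar_trisectrix_framed tangent_locus_framed. Qed.

Lemma circle_frame O r P : 0 < r -> circle O r P ->
  exists u v, orthonormal u v /\ P = framed O u v r 0.
Proof.
move=> r0 /(circleE _ _ (ltW r0)) cP.
have rN0 : r != 0 by rewrite gt_eqF.
have uu : dot (r^-1 *: (P - O)) (r^-1 *: (P - O)) = 1.
  by rewrite dotZl dotZr cP; field.
exists (r^-1 *: (P - O)), (rot90 (r^-1 *: (P - O))); split.
  by split; rewrite ?dot_rot90_rot90 ?dot_rot90.
by rewrite /framed scale0r addr0 scalerA divff // scale1r addrC subrK.
Qed.

Lemma orthonormalP u v :
  orthonormal u v <-> [/\ enorm u = 1, enorm v = 1 & dot u v = 0].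
Proof.
have e w : enorm w = 1 <-> dot w w = 1 by rewrite enormE // expr1n.
by split=> [] [/e h1 /e h2 h3].
Qed.
End PlaneGeometry.

Theorem proposition2 (R : realType) :
  (forall (O : plane R) (r : R) (l : set (plane R)) (T : plane R),
     0 < r -> tangent_at (circle O r) l T ->
     maclaurin_trisectrix (tangent_locus (circle O r) l)) /\
  (forall t : set (plane R), maclaurin_trisectrix t ->
     exists (O : plane R) (r : R) (l : set (plane R)) (T : plane R),
       [/\ 0 < r, tangent_at (circle O r) l T
         & t = tangent_locus (circle O r) l]).
Proof.
split=> [ O r l T r0 /(tangentP _ _ _ r0)[cT lE]|_ [a [C [u [v [a0 uv ->]]]]]].
  have [u [v [uv TE]]] := circle_frame r0 cT.
  exists r, O, u, v; split=> //; first exact/orthonormalP.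
  by rewrite lE TE; apply: tangent_locus_polar.
move/orthonormalP: uv => uv.
exists C, a, [set X | dot (X - C) (framed C u v a 0 - C) = a ^+ 2].
exists (framed C u v a 0); split=> //; first exact: tangent_frame.
by rewrite tangent_locus_polar.
Qed.
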